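(* The following hold: 1. $\mathsf{K}_\geq\not\leq_{\mathrm W}\mathsf{K}_{\mathbb N}'$, 2. $\mathsf{G}_\geq\not\leq_{\mathrm W}\mathsf{K}_{\mathbb N}$.
   Context: Weihrauch complexity. $f:\subseteq X\rightrightarrows Y$ denotes a partial multivalued map. A represented space $(X,\delta_X)$ is a set $X$ with a surjective partial map $\delta_X:\subseteq\mathbb N^{\mathbb N}\to X$. A partial function $F:\subseteq\mathbb N^{\mathbb N}\to\mathbb N^{\mathbb N}$ is a realizer of $f:\subseteq X\rightrightarrows Y$, written $F\vdash f$, if $\delta_YF(p)\in f(\delta_X(p))$ for all $p\in\mathrm{dom}(f\delta_X)$. A problem is a multivalued map on represented spaces that has a realizer. $\mathbb N^{\mathbb N}$, $\mathbb N$ and products carry the standard representations; $\langle\cdot\rangle$ denotes standard pairing/tupling. $f\leq_{\mathrm W}g$ holds if there are computable $H,L:\subseteq\mathbb N^{\mathbb N}\to\mathbb N^{\mathbb N}$ such that $H\langle\mathrm{id},\Gamma L\rangle\vdash f$ whenever $\Gamma\vdash g$. Jump: for a problem $f:\subseteq X\rightrightarrows Y$, with $\delta$ the representation of $X$, the jump $f'$ is the same multivalued map but with the input space represented by $\delta'=\delta\circ\lim$, where $\lim:\subseteq\mathbb N^{\mathbb N}\to\mathbb N^{\mathbb N}$, $\lim\langle p_0,p_1,\dots\rangle=\lim_{n\to\infty}p_n$. Problems. $\varphi$ is a fixed standard (acceptable) Gödel numbering of the partial computable functions $\subseteq\mathbb N\to\mathbb N$. For a (total) computable $p\in\mathbb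 N^{\mathbb N}$ let $\mathsf{G}(p)=\{i\in\mathbb N:\varphi_i=p\}$ and $\mathsf{K}(p)=\min\mathsf{G}(p)$. - $\mathsf{G}_\geq:\subseteq\mathbb N^{\mathbb N}\times\mathbb N\rightrightarrows\mathbb N$, $\mathsf{G}_\geq(p,m)=\mathsf{G}(p)$, with domain $\{(p,m):p\text{ computable},\ m\geq\mathsf{K}(p)\}$. - $\mathsf{K}_\geq:\subseteq\mathbb N^{\mathbb N}\rightrightarrows\mathbb N$, $\mathsf{K}_\geq(p)=\{m\in\mathbb N:m\geq\mathsf{K}(p)\}$, with domain the set of all computable $p$. - $\mathsf{K}_{\mathbb N}:\subseteq\mathbb N^{\mathbb N}\times\mathbb N\rightrightarrows\mathbb N$, $\mathsf{K}_{\mathbb N}(p,m)=\{n\leq m:(\forall k)\ p(k)\neq n\}$, with domain $\{(p,m):\mathrm{range}(p)\subsetneqq\{0,\dots,m\}\}$ (compact choice; not to be confused with the Kolmogorov complexity $\mathsf K$). *)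

(* Defs.v *)
From Stdlib Require Import Arith Lia Cantor.
From Stdlib Require Import Classical ClassicalEpsilon FunctionalExtensionality.

Set Implicit Arguments.

(** ** Partial functions *)

Record pfun (A B : Type) := Pfun {
  graph :> A -> B -> Prop;
  graph_functional : forall a b b', graph a b -> graph a b' -> b = b'
}.

Notation "<< x , y >>" := (Cantor.to_nat (x, y)) (at level 0).

(** ** Partial computable functions *)

(* Kleene's mu-recursive functions, presented as unary functions with the Cantor
   pairing as a basic function; [O] is the set of names of available oracles. *)
Inductive code (O : Type) : Type :=
| Oracle (o : O)
| Zero
| Succ
| Fst
| Snd
| Pair (c d : code O)
| Comp (c d : code O)
| Rec (c d : code O)
| Mu (c : code O).

Arguments Zero {O}.
Arguments Succ {O}.
Arguments Fst {O}.
Arguments Snd {O}.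

Fixpoint prim_rec (F G : nat -> nat -> Prop) (a n : nat) : nat -> Prop :=
  match n with
  | 0 => F a
  | S m => fun y => exists r, prim_rec F G a m r /\ G << a, << m, r >> >> y
  end.

(* All values below the minimum must be defined and nonzero. *)
Definition minimize (F : nat -> nat -> Prop) (x n : nat) : Prop :=
  F << x, n >> 0 /\ forall m, m < n -> exists k, F << x, m >> (S k).

(* [eval ora c x y]: program [c] with oracles [ora] halts on input [x] with output [y]. *)
Fixpoint eval {O : Type} (ora : O -> nat -> nat) (c : code O) : nat -> nat -> Prop :=
  match c with
  | Oracle o => fun x y => y = ora o x
  | Zero => fun x y => y = 0
  | Succ => fun x y => y = S x
  | Fst => fun x y => y = fst (Cantor.of_nat x)
  | Snd => fun x y => y = snd (Cantor.of_nat x)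
  | Pair c d => fun x y => exists a b, eval ora c x a /\ eval ora d x b /\ y = << a, b >>
  | Comp c d => fun x y => exists z, eval ora d x z /\ eval ora c z y
  | Rec c d => fun x =>
      prim_rec (eval ora c) (eval ora d) (fst (Cantor.of_nat x)) (snd (Cantor.of_nat x))
  | Mu c => minimize (eval ora c)
  end.

Lemma eval_functional (O : Type) (ora : O -> nat -> nat) (c : code O) x y y' :
  eval ora c x y -> eval ora c x y' -> y = y'.
Proof.
revert x y y'; induction c as [o| | | | |c IHc d IHd|c IHc d IHd|c IHc d IHd|c IHc];
  simpl; intros x y y'; try congruence.
- intros (a & b & Ha & Hb & ->) (a' & b' & Ha' & Hb' & ->).
  now rewrite (IHc _ _ _ Ha Ha'), (IHd _ _ _ Hb Hb').
- intros (z & Hz & Hy) (z' & Hz' & Hy').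
  rewrite (IHd _ _ _ Hz' Hz) in Hy'; eauto.
- generalize (fst (Cantor.of_nat x)); intros a.
  revert y y'; induction (snd (Cantor.of_nat x)) as [|n IHn]; simpl; intros y y'; eauto.
  intros (r & Hr & Hy) (r' & Hr' & Hy').
  rewrite (IHn _ _ Hr' Hr) in Hy'; eauto.
- intros [H0 H1] [H0' H1'].
  destruct (Nat.lt_trichotomy y y') as [Hlt|[Heq|Hlt]]; trivial.
  + destruct (H1' _ Hlt) as [k Hk]; discriminate (IHc _ _ _ H0 Hk).
  + destruct (H1 _ Hlt) as [k Hk]; discriminate (IHc _ _ _ H0' Hk).
Qed.

Definition no_oracle (e : Empty_set) : nat -> nat := match e with end.

Definition run (c : code Empty_set) : pfun nat nat :=
  Pfun (eval no_oracle c) (eval_functional no_oracle c).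

Definition partial_computable (f : pfun nat nat) : Prop :=
  exists c, forall x y, f x y <-> run c x y.

Definition computable (p : nat -> nat) : Prop :=
  exists c, forall x, run c x (p x).

(* Acceptable Goedel numberings, in the sense of Rogers, of the partial
   computable functions: a computable universal function and the smn property.
   By the second clause every partial computable function occurs in [phi]. *)
Definition acceptable (phi : nat -> pfun nat nat) : Prop :=
  (exists u : pfun nat nat, partial_computable u /\
     forall i x y, u << i, x >> y <-> phi i x y) /\
  (forall psi : pfun nat nat, partial_computable psi ->
     exists s : nat -> nat, computable s /\
       forall i x y, phi (s i) x y <-> psi << i, x >> y).

(** ** Baire space *)

Definition baire := nat -> nat.

Definition interleave (p q : baire) : baire :=
  fun k => if Nat.even k then p (Nat.div2 k) else q (Nat.div2 k).

(* The two components of [r = interleave p q]. *)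
Definition evens (r : baire) : baire := fun n => r (2 * n).
Definition odds (r : baire) : baire := fun n => r (2 * n + 1).

Lemma evens_interleave p q : evens (interleave p q) = p.
Proof.
apply functional_extensionality; intros n; unfold evens, interleave.
now rewrite Nat.even_even, Nat.div2_double.
Qed.

Lemma odds_interleave p q : odds (interleave p q) = q.
Proof.
apply functional_extensionality; intros n; unfold odds, interleave.
now rewrite Nat.even_odd, Nat.add_1_r, Nat.div2_succ_double.
Qed.

(* An oracle program computes the values of [F p] from those of [p]; as usual,
   restrictions of computable functions count as computable. *)
Definition computable_baire (F : pfun baire baire) : Prop :=
  exists c : code unit, forall p q, F p q ->
    forall n, eval (fun _ => p) c n (q n).

(* [r] stands for the sequence of points [p_m = fun n => r << m, n >>]; convergence
   in Baire space is pointwise eventual equality. *)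
Definition lim_graph (r q : baire) : Prop :=
  forall n, exists N, forall m, N <= m -> r << m, n >> = q n.

Lemma lim_functional r q q' : lim_graph r q -> lim_graph r q' -> q = q'.
Proof.
intros H H'; apply functional_extensionality; intros n.
destruct (H n) as [N HN], (H' n) as [N' HN'].
rewrite <- (HN (max N N')), <- (HN' (max N N')); lia.
Qed.

Definition lim : pfun baire baire := Pfun lim_graph lim_functional.

(** ** Represented spaces and problems *)

#[local] Obligation Tactic := idtac.

Record rep_space := RepSpace {
  carrier :> Type;
  rep : pfun baire carrier;
  rep_surjective : forall x, exists p, rep p x
}.

Program Definition baire_space : rep_space :=
  {| carrier := baire; rep := Pfun (fun p x => p = x) _ |}.
Next Obligation. congruence. Qed.
Next Obligation. intros x; now exists x. Qed.

Program Definition nat_space : rep_space :=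
  {| carrier := nat; rep := Pfun (fun p x => p 0 = x) _ |}.
Next Obligation. simpl; congruence. Qed.
Next Obligation. intros x; now exists (fun _ => x). Qed.

Program Definition prod_space (X Y : rep_space) : rep_space :=
  {| carrier := X * Y;
     rep := Pfun (fun r xy => rep X (evens r) (fst xy) /\ rep Y (odds r) (snd xy)) _ |}.
Next Obligation.
intros X Y r [x y] [x' y'] [Hx Hy] [Hx' Hy']; simpl in *.
f_equal; eapply graph_functional; eauto.
Qed.
Next Obligation.
intros X Y [x y]; destruct (rep_surjective X x) as [p Hp], (rep_surjective Y y) as [q Hq].
exists (interleave p q); simpl; now rewrite evens_interleave, odds_interleave.
Qed.

Program Definition jump_space (X : rep_space) : rep_space :=
  {| carrier := X; rep := Pfun (fun r x => exists p, lim r p /\ rep X p x) _ |}.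
Next Obligation.
intros X r x x' (p & Hr & Hx) (p' & Hr' & Hx').
rewrite (lim_functional Hr' Hr) in Hx'; eapply graph_functional; eauto.
Qed.
Next Obligation.
intros X x; destruct (rep_surjective X x) as [p Hp].
exists (fun k => p (snd (Cantor.of_nat k))), p; split; trivial.
intros n; exists 0; intros m _; now rewrite Cantor.cancel_of_to.
Qed.

(* A multivalued map is the relation [f x y] of its values; its domain consists of the
   [x] having at least one value. *)
Definition realizes {X Y : rep_space} (F : pfun baire baire) (f : X -> Y -> Prop) : Prop :=
  forall p x, rep X p x -> (exists y, f x y) ->
    exists q y, F p q /\ rep Y q y /\ f x y.

Record problem := Problem {
  input : rep_space;
  output : rep_space;
  values :> input -> output -> Prop;
  has_realizer : exists F, realizes F values
}.

(* With the axiom of choice, every multivalued map on represented spaces has a realizer. *)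
Lemma realizer_exists (X Y : rep_space) (f : X -> Y -> Prop) : exists F, realizes F f.
Proof.
set (good := fun p q => exists x y, rep X p x /\ rep Y q y /\ f x y).
assert (functional : forall p q q',
  good p q /\ q = epsilon (inhabits p) (good p) ->
  good p q' /\ q' = epsilon (inhabits p) (good p) -> q = q').
{ intros p q q' [_ ->] [_ ->]; reflexivity. }
exists (Pfun _ functional); intros p x Hx [y Hy].
destruct (rep_surjective Y y) as [q Hq].
assert (H : good p (epsilon (inhabits p) (good p))).
{ apply epsilon_spec; exists q, x, y; auto. }
pose proof H as (x' & y' & Hx' & Hy' & Hf).
rewrite (graph_functional (rep X) _ _ _ Hx' Hx) in Hf.
eexists; exists y'; repeat split; eauto.
Qed.

Definition mk_problem (X Y : rep_space) (f : X -> Y -> Prop) : problem :=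
  {| values := f; has_realizer := realizer_exists X Y f |}.

Definition jump (f : problem) : problem :=
  mk_problem (jump_space (input f)) (output f) (values f).

(* The partial function [p |-> H <p, G (L p)>]. *)
Program Definition reduction (H L G : pfun baire baire) : pfun baire baire :=
  Pfun (fun p q => exists r s, L p r /\ G r s /\ H (interleave p s) q) _.
Next Obligation.
intros H L G p q q' (r & s & Hr & Hs & Hq) (r' & s' & Hr' & Hs' & Hq').
rewrite (graph_functional L _ _ _ Hr' Hr) in Hs'.
rewrite (graph_functional G _ _ _ Hs' Hs) in Hq'.
eapply graph_functional; eauto.
Qed.

Definition weihrauch_le (f g : problem) : Prop :=
  exists H L : pfun baire baire, computable_baire H /\ computable_baire L /\
    forall G, realizes G g -> realizes (reduction H L G) f.

(** ** Goedel numbers, Kolmogorov complexity and compact choice *)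

Definition goedel_number (phi : nat -> pfun nat nat) (p : baire) (i : nat) : Prop :=
  forall x y, phi i x y <-> p x = y.

Definition kolmogorov (phi : nat -> pfun nat nat) (p : baire) (k : nat) : Prop :=
  goedel_number phi p k /\ forall i, goedel_number phi p i -> k <= i.

Definition above_kolmogorov (phi : nat -> pfun nat nat) (p : baire) (m : nat) : Prop :=
  exists k, kolmogorov phi p k /\ k <= m.

Definition G_ge (phi : nat -> pfun nat nat) : problem :=
  mk_problem (prod_space baire_space nat_space) nat_space
    (fun pm i => let (p, m) := pm in
       (computable p /\ above_kolmogorov phi p m) /\ goedel_number phi p i).

Definition K_ge (phi : nat -> pfun nat nat) : problem :=
  mk_problem baire_space nat_space
    (fun p m => computable p /\ above_kolmogorov phi p m).

(* The first two conjuncts state that the range of [p] is a proper subset of {0,...,m}. *)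
Definition K_N : problem :=
  mk_problem (prod_space baire_space nat_space) nat_space
    (fun pm n => let (p, m) := pm in
       ((forall k, p k <= m) /\ (exists j, j <= m /\ forall k, p k <> j)) /\
       (n <= m /\ forall k, p k <> n)).

(* Main.v *)
Require Import Defs.
From Stdlib Require Import Arith Lia Cantor.
From Stdlib Require Import Classical ClassicalEpsilon.

(** Both parts start from the same remark.  Correct answers to an instance [(q, k)] of
    compact choice are numbers [n <= k], and a reduction to compact choice must turn
    every correct [n] into a correct answer to the original question
    ([weihrauch_le_pointwise]).  There are only [k + 1] candidates, so they can be tried
    in parallel, and the programs of the reduction can be run on finite parts of their
    oracles, because a halting computation reads only finitely much of its oracle
    ([approx_sound], [approx_complete]) and such finite runs are computable
    ([computable_approx]).

    _Compact choice with a limit input does not bound the complexity._  Here [k] is only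
    known in the limit.  Still, the sum over all [n <= k] of the answers computed from [n]
    is a number that can be guessed from longer and longer prefixes of [p], and for every
    computable [p] the guesses settle on an upper bound of the complexity of [p]
    ([guess_converges]).  No computable guessing procedure can do this: if the guess at
    some prefix [w] changed on no extension of [w], then all computable [p] extending [w],
    which are infinitely many, would have bounded complexity.  So each prefix has an
    extension on which the guess changes, and a search for such extensions, repeated
    forever, computes a [p] on which the guesses do not settle
    ([changing_guess_diverges]).

    _Compact choice does not find Goedel numbers._  By the recursion theorem there is an
    index [e] of a function [p] that depends on [m = e + e0], where [e0] is an index of the
    zero function.  As the complexities of [p] and of the zero function are at most [m],
    the reduction must work on [(p, m)] and on [(zeros, m)].  On [(zeros, m)] each
    candidate [n] is either removed (enumerated by [q]) or it is correct and yields an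
    index [i] of the zero function, so that [phi i] is defined everywhere.  One can
    therefore find a position [x], beyond everything the reduction reads on the zero
    function, such that each [n <= k] is either removed or yields an [i] for which
    [phi i x] halts.  Let [p] be zero except at [x], where it takes a value different from
    all these values of [phi i x].  The reduction behaves on [p] as on the zero function,
    since the position [x] was never read; so every candidate is removed or yields a number
    that is not an index of [p]. *)

Set Implicit Arguments.

(** * Computable functions *)

Definition pi1 (z : nat) : nat := fst (Cantor.of_nat z).
Definition pi2 (z : nat) : nat := snd (Cantor.of_nat z).

Lemma pi1_pair a b : pi1 << a, b >> = a.
Proof. unfold pi1; now rewrite Cantor.cancel_of_to. Qed.

Lemma pi2_pair a b : pi2 << a, b >> = b.
Proof. unfold pi2; now rewrite Cantor.cancel_of_to. Qed.

Lemma pair_pi z : << pi1 z, pi2 z >> = z.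
Proof. unfold pi1, pi2; now rewrite <- surjective_pairing, Cantor.cancel_to_of. Qed.

Definition computable2 (f : nat -> nat -> nat) : Prop :=
  computable (fun z => f (pi1 z) (pi2 z)).

Definition computable3 (f : nat -> nat -> nat -> nat) : Prop :=
  computable (fun z => f (pi1 z) (pi1 (pi2 z)) (pi2 (pi2 z))).

Lemma computable_ext f g : computable f -> (forall x, f x = g x) -> computable g.
Proof. intros [c Hc] E; exists c; intros x; rewrite <- E; apply Hc. Qed.

Lemma computable_id : computable (fun x => x).
Proof.
exists (Pair Fst Snd); intros x; exists (pi1 x), (pi2 x); repeat split.
symmetry; apply pair_pi.
Qed.

Lemma computable_comp f g : computable f -> computable g -> computable (fun x => f (g x)).
Proof. intros [c Hc] [d Hd]; exists (Comp c d); intros x; exists (g x); split; [apply Hd|apply Hc]. Qed.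

Lemma computable_succ f : computable f -> computable (fun x => S (f x)).
Proof. intros H; apply computable_comp with (f := S); trivial; exists Succ; intros x; reflexivity. Qed.

Lemma computable_const n : computable (fun _ => n).
Proof.
induction n as [|n IHn].
- exists Zero; intros x; reflexivity.
- apply computable_succ, IHn.
Qed.

Lemma computable_pi1 f : computable f -> computable (fun x => pi1 (f x)).
Proof. intros H; apply computable_comp; trivial; exists Fst; intros x; reflexivity. Qed.

Lemma computable_pi2 f : computable f -> computable (fun x => pi2 (f x)).
Proof. intros H; apply computable_comp; trivial; exists Snd; intros x; reflexivity. Qed.

Lemma computable_pair f g : computable f -> computable g -> computable (fun x => << f x, g x >>).
Proof.
intros [c Hc] [d Hd]; exists (Pair c d); intros x.
exists (f x), (g x); split; [apply Hc|split; [apply Hd|trivial]].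
Qed.

Create HintDb computability.
#[local] Hint Resolve computable_id computable_succ computable_const computable_pi1
  computable_pi2 computable_pair : computability.
#[local] Hint Extern 0 (computable2 _) => unfold computable2; cbv beta : computability.
#[local] Hint Extern 0 (computable3 _) => unfold computable3; cbv beta : computability.

(** In the lemmas below a function of several arguments is presented as a family of unary
    functions of a common context [x]; this is the shape on which proof search can act. *)
Lemma computable2_apply f a b :
  computable2 f -> computable a -> computable b -> computable (fun x => f (a x) (b x)).
Proof.
intros Hf Ha Hb.
apply computable_ext with (1 := computable_comp Hf (computable_pair Ha Hb)).
intros x; now rewrite pi1_pair, pi2_pair.
Qed.

Lemma computable_rec a g n :
  computable a -> computable3 g -> computable n ->
  computable (fun x => nat_rect (fun _ => nat) (a x) (g x) (n x)).
Proof.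
intros [ca Ha] [cg Hg] Hn.
assert (Hrec : computable2 (fun x => nat_rect (fun _ => nat) (a x) (g x))).
{ exists (Rec ca cg); intros z; simpl; fold (pi1 z) (pi2 z).
  induction (pi2 z) as [|m IHm]; simpl.
  - apply Ha.
  - exists (nat_rect (fun _ => nat) (a (pi1 z)) (g (pi1 z)) m); split; trivial.
    specialize (Hg << pi1 z, << m, nat_rect (fun _ => nat) (a (pi1 z)) (g (pi1 z)) m >> >>).
    now rewrite !pi2_pair, !pi1_pair in Hg. }
apply (computable2_apply Hrec); auto with computability.
Qed.

Lemma computable_match t a b :
  computable t -> computable a -> computable2 b ->
  computable (fun x => match t x with 0 => a x | S n => b x n end).
Proof.
intros Ht Ha Hb.
assert (H : computable (fun x => nat_rect (fun _ => nat) (a x) (fun n _ => b x n) (t x))).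
{ apply computable_rec; trivial.
  apply computable2_apply with (f := b); auto with computability. }
apply computable_ext with (1 := H); intros x; now destruct (t x).
Qed.

#[local] Hint Resolve computable_rec computable_match : computability.

Lemma computable_pred f : computable f -> computable (fun x => pred (f x)).
Proof. intros Hf; unfold pred; auto with computability. Qed.

#[local] Hint Resolve computable_pred : computability.

Lemma computable_add f g : computable f -> computable g -> computable (fun x => f x + g x).
Proof.
intros Hf Hg.
apply computable_ext with
  (fun x => nat_rect (fun _ => nat) (g x) (fun _ r => S r) (f x)); auto 10 with computability.
intros x; induction (f x); simpl; congruence.
Qed.

Lemma computable_sub f g : computable f -> computable g -> computable (fun x => f x - g x).
Proof.
intros Hf Hg.
apply computable_ext with
  (fun x => nat_rect (fun _ => nat) (f x) (fun _ r => pred r) (g x)); auto 10 with computability.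
intros x; induction (g x); simpl; lia.
Qed.

#[local] Hint Resolve computable_add computable_sub : computability.

Lemma computable_mul f g : computable f -> computable g -> computable (fun x => f x * g x).
Proof.
intros Hf Hg.
apply computable_ext with
  (fun x => nat_rect (fun _ => nat) 0 (fun _ r => g x + r) (f x)).
- apply computable_rec; auto with computability.
  unfold computable3; apply computable_add; auto with computability.
  apply computable_comp; auto with computability.
- intros x; induction (f x); simpl; congruence.
Qed.

Fixpoint sum (f : nat -> nat) (n : nat) : nat :=
  match n with 0 => 0 | S m => f m + sum f m end.

Fixpoint prod (f : nat -> nat) (n : nat) : nat :=
  match n with 0 => 1 | S m => f m * prod f m end.

Definition dist (a b : nat) : nat := (a - b) + (b - a).

Lemma sum_ge f n i : i < n -> f i <= sum f n.
Proof.
induction n as [|n IHn]; simpl; [lia|]; intros Hi.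
destruct (Nat.eq_dec i n) as [->|]; [lia|]; assert (f i <= sum f n) by (apply IHn; lia); lia.
Qed.

Lemma sum_zero f n : (forall i, i < n -> f i = 0) -> sum f n = 0.
Proof. induction n as [|n IHn]; simpl; trivial; intros H; rewrite IHn, H; auto. Qed.

Lemma sum_ext f g n : (forall i, i < n -> f i = g i) -> sum f n = sum g n.
Proof. induction n as [|n IHn]; simpl; trivial; intros H; rewrite IHn, H; auto. Qed.

Lemma prod_zero f n i : i < n -> f i = 0 -> prod f n = 0.
Proof.
induction n as [|n IHn]; simpl; [lia|]; intros Hi Hf.
destruct (Nat.eq_dec i n) as [->|]; [now rewrite Hf|]; rewrite IHn; trivial; lia.
Qed.

Lemma prod_zero_inv f n : prod f n = 0 -> exists i, i < n /\ f i = 0.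
Proof.
induction n as [|n IHn]; simpl; [discriminate|]; intros H.
apply Nat.mul_eq_0 in H; destruct H as [H|H]; [exists n; auto|].
destruct (IHn H) as (i & Hi & Hf); exists i; auto.
Qed.

Lemma prod_ge f n i : prod f n <> 0 -> i < n -> f i <= prod f n.
Proof.
induction n as [|n IHn]; simpl; [lia|]; intros H Hi.
apply Nat.neq_mul_0 in H; destruct (Nat.eq_dec i n) as [->|]; [nia|].
assert (f i <= prod f n) by (apply IHn; lia || apply H); nia.
Qed.

Lemma computable_sum f n :
  computable2 f -> computable n -> computable (fun x => sum (f x) (n x)).
Proof.
intros Hf Hn.
apply computable_ext with (fun x => nat_rect (fun _ => nat) 0 (fun m r => f x m + r) (n x)).
- apply computable_rec; auto with computability.
  unfold computable3; apply computable_add; auto with computability.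
  apply computable2_apply with (f := f); auto with computability.
- intros x; induction (n x); simpl; congruence.
Qed.

Lemma computable_prod f n :
  computable2 f -> computable n -> computable (fun x => prod (f x) (n x)).
Proof.
intros Hf Hn.
apply computable_ext with (fun x => nat_rect (fun _ => nat) 1 (fun m r => f x m * r) (n x)).
- apply computable_rec; auto with computability.
  unfold computable3; apply computable_mul; auto with computability.
  apply computable2_apply with (f := f); auto with computability.
- intros x; induction (n x); simpl; congruence.
Qed.

Lemma computable_dist f g : computable f -> computable g -> computable (fun x => dist (f x) (g x)).
Proof. intros Hf Hg; unfold dist; auto with computability. Qed.

#[local] Hint Resolve computable_mul computable_sum computable_prod computable_dist
  : computability.

(* [Nat.even] is not a numerical function, so [interleave] is recast with this one. *)
Definition parity (n : nat) : nat := nat_rect (fun _ => nat) 0 (fun _ r => 1 - r) n.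

Lemma parity_even n : parity n = if Nat.even n then 0 else 1.
Proof.
induction n as [|n IHn]; trivial.
change (parity (S n)) with (1 - parity n); rewrite Nat.even_succ, <- Nat.negb_even, IHn.
now destruct (Nat.even n).
Qed.

(** Half of [n] is the number of odd numbers below [n]. *)
Lemma computable_div2 f : computable f -> computable (fun x => Nat.div2 (f x)).
Proof.
intros Hf; apply computable_ext with (fun x => sum parity (f x)).
- unfold parity; auto 10 with computability.
- intros x; induction (f x) as [|n IHn]; trivial; simpl sum; rewrite IHn, parity_even.
  pose proof (Nat.div2_odd n) as E; pose proof (Nat.div2_odd (S n)) as E'.
  rewrite Nat.odd_succ in E'; rewrite <- Nat.negb_even in E.
  destruct (Nat.even n); cbv [negb Nat.b2n] in *; lia.
Qed.

#[local] Hint Resolve computable_div2 : computability.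

Lemma computable_interleave o o' a :
  computable2 o -> computable2 o' -> computable a ->
  computable (fun z => interleave (o z) (o' z) (a z)).
Proof.
intros Ho Ho' Ha.
apply computable_ext with
  (fun z => match parity (a z) with
            | 0 => o z (Nat.div2 (a z))
            | S _ => o' z (Nat.div2 (a z)) end).
- unfold parity; apply computable_match; [auto 10 with computability| |].
  + apply computable2_apply with (f := o); auto with computability.
  + unfold computable2; apply computable2_apply with (f := o'); auto with computability.
    apply computable_div2, computable_comp; auto with computability.
- intros z; unfold interleave; rewrite parity_even; now destruct (Nat.even (a z)).
Qed.

#[local] Hint Resolve computable_interleave : computability.

Lemma least (P : nat -> Prop) n : P n -> exists k, P k /\ forall i, P i -> k <= i.
Proof.
induction n as [n IHn] using lt_wf_ind; intros Hn.
destruct (classic (exists i, i < n /\ P i)) as [(i & Hi & HP)|H]; [eauto|].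
exists n; split; trivial; intros i Hi.
destruct (le_lt_dec n i) as [|Hlt]; trivial; destruct H; eauto.
Qed.

(** Unbounded search, in the case where it always succeeds. *)
Lemma computable_search f :
  computable2 f -> (forall x, exists n, f x n = 0) ->
  exists g, computable g /\ forall x, f x (g x) = 0.
Proof.
intros [c Hc] Hf.
assert (Hl : forall x, exists n, f x n = 0 /\ forall i, f x i = 0 -> n <= i).
{ intros x; destruct (Hf x) as [n Hn]; exact (least _ _ Hn). }
set (g := fun x => proj1_sig (constructive_indefinite_description _ (Hl x))).
assert (Hg : forall x, f x (g x) = 0 /\ forall i, f x i = 0 -> g x <= i).
{ intros x; exact (proj2_sig (constructive_indefinite_description _ (Hl x))). }
exists g; split; [|apply Hg].
assert (Hc' : forall x n, eval no_oracle c << x, n >> (f x n)).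
{ intros x n; generalize (Hc << x, n >>); now rewrite pi1_pair, pi2_pair. }
exists (Mu c); intros x; destruct (Hg x) as [H0 Hmin]; split.
- rewrite <- H0; apply Hc'.
- intros m Hm; exists (pred (f x m)).
  replace (S (pred (f x m))) with (f x m); [apply Hc'|].
  destruct (f x m) eqn:E; trivial; apply Hmin in E; lia.
Qed.

(** * Finite approximations of oracle computations *)

(** One step of the search for a zero of the function that [f] approximates, where [f n = 0]
    means that no value is known and [f n = S v] that the value is [v].  The state is [0]
    while all values seen are positive, [1] once an unknown value blocks the search, and
    [S (S n)] when the zero [n] has been found. *)
Definition search_step (f : nat -> nat) (n r : nat) : nat :=
  match r with
  | 0 => match f n with 0 => 1 | S v => match v with 0 => S (S n) | S _ => 0 end end
  | S _ => r
  end.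

(** A total approximation to [eval]: unbounded searches are cut off at [s], and [o] is a
    partial oracle.  In [o] as in the result, [0] stands for a missing value and [S v] for
    the value [v].  All oracle names are answered by the same [o], since at most one
    oracle is in use here. *)
Fixpoint approx {O : Type} (c : code O) (o : nat -> nat) (s x : nat) : nat :=
  match c with
  | Oracle _ => o x
  | Zero => 1
  | Succ => S (S x)
  | Fst => S (pi1 x)
  | Snd => S (pi2 x)
  | Pair c d =>
      match approx c o s x with
      | 0 => 0
      | S a => match approx d o s x with 0 => 0 | S b => S << a, b >> end
      end
  | Comp c d => match approx d o s x with 0 => 0 | S z => approx c o s z end
  | Rec c d =>
      nat_rect (fun _ => nat) (approx c o s (pi1 x))
        (fun m r => match r with 0 => 0 | S r => approx d o s << pi1 x, << m, r >> >> end)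
        (pi2 x)
  | Mu c =>
      pred (nat_rect (fun _ => nat) 0 (search_step (fun n => approx c o s << x, n >>)) s)
  end.

Lemma search_sound f s n :
  nat_rect (fun _ => nat) 0 (search_step f) s = S (S n) ->
  f n = 1 /\ forall m, m < n -> exists k, f m = S (S k).
Proof.
set (F := nat_rect (fun _ => nat) 0 (search_step f)).
assert (H0 : forall s, F s = 0 -> forall m, m < s -> exists k, f m = S (S k)).
{ clear s; induction s as [|s IHs]; [lia|]; simpl; unfold search_step at 1; fold (F s).
  destruct (F s); [|discriminate].
  destruct (f s) as [|[|k]] eqn:E; try discriminate; intros _ m Hm.
  destruct (Nat.eq_dec m s) as [->|]; [eauto|apply IHs; trivial; lia]. }
induction s as [|s IHs]; [discriminate|]; simpl; unfold search_step at 1; fold (F s).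
destruct (F s) eqn:E0; [|intros E; apply IHs; congruence].
destruct (f s) as [|[|k]] eqn:E; try discriminate; intros [= <-]; split; [trivial|exact (H0 s E0)].
Qed.

Lemma search_complete f n s :
  f n = 1 -> (forall m, m < n -> exists k, f m = S (S k)) -> n < s ->
  nat_rect (fun _ => nat) 0 (search_step f) s = S (S n).
Proof.
intros H1 Hm.
set (F := nat_rect (fun _ => nat) 0 (search_step f)).
assert (H0 : forall s, s <= n -> F s = 0).
{ clear s; induction s as [|s IHs]; trivial; intros Hs.
  simpl; unfold search_step at 1; fold (F s); rewrite IHs by lia.
  destruct (Hm s Hs) as [k ->]; trivial. }
induction 1 as [|s Hs IHs]; simpl; unfold search_step at 1.
- fold (F n); now rewrite H0, H1.
- fold (F s); now rewrite IHs.
Qed.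

Lemma approx_sound O (ora : O -> nat -> nat) o s (c : code O) :
  (forall i z v, o z = S v -> ora i z = v) ->
  forall x y, approx c o s x = S y -> eval ora c x y.
Proof.
intros Ho; induction c as [i| | | | |c IHc d IHd|c IHc d IHd|c IHc d IHd|c IHc];
  simpl; intros x y.
- intros E; symmetry; eauto.
- congruence.
- congruence.
- intros [= <-]; reflexivity.
- intros [= <-]; reflexivity.
- destruct (approx c o s x) as [|a] eqn:Ea; [discriminate|].
  destruct (approx d o s x) as [|b] eqn:Eb; [discriminate|].
  intros [= <-]; exists a, b; auto.
- destruct (approx d o s x) as [|z] eqn:Ez; [discriminate|]; intros E; exists z; auto.
- fold (pi1 x) (pi2 x); revert y; induction (pi2 x) as [|m IHm]; simpl; [auto|]; intros y.
  destruct (nat_rect _ _ _ m) as [|r]; [discriminate|]; intros E; exists r; auto.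
- destruct (nat_rect _ _ _ s) as [|[|n]] eqn:E; try discriminate; intros [= <-].
  destruct (search_sound _ _ E) as [H1 Hm]; split; [auto|].
  intros m Hlt; destruct (Hm m Hlt) as [k Hk]; exists k; auto.
Qed.

Lemma eventually_all (P : nat -> nat -> Prop) k :
  (forall n, n < k -> exists N, forall s, N <= s -> P n s) ->
  exists N, forall s, N <= s -> forall n, n < k -> P n s.
Proof.
induction k as [|k IHk]; intros H; [exists 0; lia|].
destruct IHk as [N HN]; [intros n Hn; apply H; lia|].
destruct (H k) as [N' HN']; [lia|].
exists (max N N'); intros s Hs n Hn.
destruct (Nat.eq_dec n k) as [->|]; [apply HN'|apply HN]; lia.
Qed.

Definition agree_below (N : nat) (o p : nat -> nat) : Prop :=
  forall z, z < N -> o z = S (p z).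

Lemma agree_below_le N N' o p : N <= N' -> agree_below N' o p -> agree_below N o p.
Proof. intros HN H z Hz; apply H; lia. Qed.

Lemma agree_below_interleave N o p o' p' :
  agree_below N o p -> agree_below N o' p' -> agree_below N (interleave o o') (interleave p p').
Proof.
intros H H' z Hz; unfold interleave; pose proof (Nat.div2_decr z z (Nat.le_succ_diag_r z)).
destruct (Nat.even z); [apply H|apply H']; lia.
Qed.

(** The use principle: a halting computation is reproduced by every sufficiently good
    finite approximation, with one threshold [N] for the search bound and the oracle. *)
Lemma approx_complete O (ora : O -> nat -> nat) (c : code O) x y :
  eval ora c x y ->
  exists N, forall s, N <= s -> forall o, (forall i, agree_below N o (ora i)) ->
    approx c o s x = S y.
Proof.
revert x y; induction c as [i| | | | |c IHc d IHd|c IHc d IHd|c IHc d IHd|c IHc];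
  simpl; intros x y.
- intros ->; exists (S x); intros s _ o Ho; apply Ho; lia.
- intros ->; exists 0; trivial.
- intros ->; exists 0; trivial.
- intros ->; exists 0; trivial.
- intros ->; exists 0; trivial.
- intros (a & b & Ha & Hb & ->).
  destruct (IHc _ _ Ha) as [N HN], (IHd _ _ Hb) as [N' HN'].
  exists (max N N'); intros s Hs o Ho.
  rewrite HN, HN'; trivial; try lia; intros i; apply (agree_below_le (N' := max N N')); auto; lia.
- intros (z & Hz & Hy).
  destruct (IHd _ _ Hz) as [N HN], (IHc _ _ Hy) as [N' HN'].
  exists (max N N'); intros s Hs o Ho.
  rewrite HN, HN'; trivial; try lia; intros i; apply (agree_below_le (N' := max N N')); auto; lia.
- fold (pi1 x) (pi2 x); revert y; induction (pi2 x) as [|m IHm]; simpl; [auto|]; intros y.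
  intros (r & Hr & Hy).
  destruct (IHm _ Hr) as [N HN], (IHd _ _ Hy) as [N' HN'].
  exists (max N N'); intros s Hs o Ho.
  rewrite HN, HN'; trivial; try lia; intros i; apply (agree_below_le (N' := max N N')); auto; lia.
- intros [H0 Hpos].
  destruct (IHc _ _ H0) as [N HN].
  destruct (eventually_all (fun m s => forall o, (forall i, agree_below s o (ora i)) ->
    forall s', s <= s' -> exists k, approx c o s' << x, m >> = S (S k)) (k := y)) as [N' HN'].
  { intros m Hm; destruct (Hpos m Hm) as [k Hk]; destruct (IHc _ _ Hk) as [M HM].
    exists M; intros s Hs o Ho s' Hs'; exists k; apply HM; [lia|].
    intros i; apply agree_below_le with s; auto. }
  exists (S (max y (max N N'))); intros s Hs o Ho.
  rewrite search_complete with (n := y); trivial; try lia.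
  + apply HN; [lia|]; intros i; eapply agree_below_le; [|apply Ho]; lia.
  + intros m Hm; apply (HN' N') with (n := m); trivial; try lia.
    intros i; eapply agree_below_le; [|apply Ho]; lia.
Qed.

(** For a fixed program no universal machine is needed: the code that evaluates the
    approximation is built along the structure of the program. *)
Lemma computable_approx O (c : code O) o s x :
  computable2 o -> computable s -> computable x ->
  computable (fun z => approx c (o z) (s z) (x z)).
Proof.
intros Ho Hs Hx.
(* Inside a recursion or a search the context grows while the oracle stays the same, so
   the index [w] of the oracle has to be separated from the context. *)
enough (H : forall w s x, computable w -> computable s -> computable x ->
  computable (fun z => approx c (o (w z)) (s z) (x z))) by (apply H; auto with computability).
clear s x Hs Hx; induction c as [i| | | | |c IHc d IHd|c IHc d IHd|c IHc d IHd|c IHc];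
  intros w s x Hw Hs Hx; cbn [approx];
  pose proof (fun a => computable_comp (g := a) Hw) as Hw';
  pose proof (fun a => computable_comp (g := a) Hs) as Hs';
  pose proof (fun a => computable_comp (g := a) Hx) as Hx'; auto 20 with computability.
- apply computable2_apply with (f := o); trivial.
- unfold search_step; auto 20 with computability.
Qed.

#[local] Hint Resolve computable_approx : computability.

(** * Goedel numberings *)

Lemma universal_code phi :
  acceptable phi -> exists c, forall i x y, eval no_oracle c << i, x >> y <-> phi i x y.
Proof.
intros [(u & [c Hc] & Hu) _]; exists c; intros i x y; rewrite <- Hu; symmetry; apply Hc.
Qed.

Lemma goedel_number_exists phi p :
  acceptable phi -> computable p -> exists i, goedel_number phi p i.
Proof.
intros [_ Hsmn] Hp.
destruct (computable_pi2 computable_id) as [d Hd], Hp as [c Hc].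
destruct (Hsmn (run (Comp c d))) as (s & _ & Hs); [now exists (Comp c d)|].
exists (s 0); intros x y; rewrite Hs.
assert (H : eval no_oracle (Comp c d) << 0, x >> (p x)).
{ exists x; split; [|apply Hc]; generalize (Hd << 0, x >>); now rewrite pi2_pair. }
split; [exact (eval_functional _ _ _ _ _ H)|intros <-; exact H].
Qed.

(** Kleene's diagonal argument: [s i] is an index of the function [f (phi i i)], and
    [e = s j] for an index [j] of [s], so that [phi j j = s j = e]. *)
Lemma recursion_theorem phi f :
  acceptable phi -> computable2 f -> exists e, goedel_number phi (f e) e.
Proof.
intros Hphi [c Hc].
destruct (universal_code Hphi) as [u Hu].
pose proof (proj2 Hphi) as Hsmn.
set (psi := Comp c (Pair (Comp u (Pair Fst Fst)) Snd)).
destruct (Hsmn (run psi)) as (s & Hs & Hpsi); [now exists psi|].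
destruct (goedel_number_exists Hphi Hs) as [j Hj].
exists (s j); intros x y; rewrite Hpsi.
assert (H : eval no_oracle psi << j, x >> (f (s j) x)).
{ exists << s j, x >>; split.
  - exists (s j), x; split; [|split; [symmetry; apply pi2_pair|trivial]].
    exists << j, j >>; split; [|now apply Hu, Hj].
    exists j, j; split; [|split; trivial]; symmetry; apply pi1_pair.
  - generalize (Hc << s j, x >>); now rewrite pi1_pair, pi2_pair. }
split; [exact (eval_functional _ _ _ _ _ H)|intros <-; exact H].
Qed.

Lemma above_kolmogorov_iff phi p m :
  above_kolmogorov phi p m <-> exists i, goedel_number phi p i /\ i <= m.
Proof.
split.
- intros (k & [Hk _] & Hm); eauto.
- intros (i & Hi & Hm); destruct (least _ _ Hi) as (k & Hk & Hmin).
  exists k; split; [now split|]; specialize (Hmin i Hi); lia.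
Qed.

(** * Weihrauch reducibility *)

(** Weihrauch reducibility without realizers: the program [cH] must succeed on every
    name of every correct answer to the instance computed by [cL]. *)
Definition reduces_pointwise (f g : problem) (cH cL : code unit) : Prop :=
  forall p x, rep (input f) p x -> (exists y, f x y) ->
    exists r z, (forall n, eval (fun _ => p) cL n (r n)) /\
      rep (input g) r z /\ (exists w, g z w) /\
      forall s w, rep (output g) s w -> g z w ->
        exists q y, (forall n, eval (fun _ => interleave p s) cH n (q n)) /\
          rep (output f) q y /\ f x y.

(** A realizer of [g] may return any name [s0] of a correct answer, so a reduction that
    works for all realizers works for all [s0].  The realizers used here are defined only
    on names of points in the domain of [g]; this forces [L] to produce such names. *)
Lemma weihrauch_le_pointwise f g :
  weihrauch_le f g -> exists cH cL, reduces_pointwise f g cH cL.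
Proof.
intros (H & L & [cH HcH] & [cL HcL] & Hred); exists cH, cL; intros p x Hx Hdom.
set (good := fun r s => exists z w, rep (input g) r z /\ rep (output g) s w /\ g z w).
(* A realizer that returns the answer [s0] wherever [s0] is correct. *)
set (pick := fun s0 r =>
  epsilon (inhabits s0) (fun s => good r s /\ (good r s0 -> s = s0))).
assert (functional : forall s0 r s s', good r s /\ s = pick s0 r ->
  good r s' /\ s' = pick s0 r -> s = s') by (intros s0 r s s' [_ ->] [_ ->]; trivial).
assert (Hreal : forall s0, realizes (Pfun _ (functional s0)) g).
{ intros s0 r z Hz [w Hw].
  destruct (rep_surjective (output g) w) as [s Hs].
  assert (Hp : good r (pick s0 r) /\ (good r s0 -> pick s0 r = s0)).
  { unfold pick; apply epsilon_spec.
    destruct (classic (good r s0)); [exists s0; auto|].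
    exists s; split; [exists z, w; auto|contradiction]. }
  destruct Hp as [Hp _]; pose proof Hp as (z' & w' & Hz' & Hw' & Hg).
  rewrite (graph_functional (rep (input g)) _ _ _ Hz' Hz) in Hg.
  exists (pick s0 r), w'; repeat split; trivial. }
destruct (Hred _ (Hreal p) p x Hx Hdom) as (q0 & y0 & (r & s1 & HL & [Hgood _] & _) & _).
destruct Hgood as (z & w1 & Hz & Hw1 & Hg1).
exists r, z; split; [now apply HcL|]; split; [trivial|]; split; [eauto|].
intros s w Hs Hw.
destruct (Hred _ (Hreal s) p x Hx Hdom) as (q & y & (r' & s' & HL' & [Hgood' ->] & HH) & Hq & Hy).
rewrite (graph_functional L _ _ _ HL' HL) in *.
assert (E : pick s r = s).
{ unfold pick; apply (epsilon_spec (inhabits s) (fun t => good r t /\ (good r s -> t = s))).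
  - exists s; split; trivial; exists z, w; auto.
  - exists z, w; auto. }
rewrite E in HH; exists q, y; auto.
Qed.

(** * Compact choice does not find Goedel numbers *)

(** The zero function with an unknown value at [x], as a partial oracle. *)
Definition punctured (x z : nat) : nat := match dist z x with 0 => 0 | S _ => 1 end.

(* The standard name of the pair of the zero function and [m], with the same hole. *)
Definition query (m x : nat) : nat -> nat := interleave (punctured x) (fun _ => S m).

(** A number which, if positive, makes candidate [n] fail for every function that is zero
    except at [x] and at least this large at [x]; [0] means that [s] steps do not suffice
    to tell.  If [n] has been enumerated, in which case the product vanishes, it fails
    anyway.  Otherwise the number is [S v], where [v] is the value at [x] of the function
    whose index is computed from [n]. *)
Definition forbidden (cH cL : code unit) (cU : code Empty_set) (m x s n : nat) : nat :=
  match prod (fun t => dist (approx cL (query m x) s (2 * t)) (S n)) s with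
  | 0 => 1
  | S _ =>
      match approx cH (interleave (query m x) (fun _ => S n)) s 0 with
      | 0 => 0
      | S i => approx cU (fun _ => 0) s << i, x >>
      end
  end.

(** The product of the bounds for all candidates combines two tasks: it is positive only
    if all of them are, and then it is at least as large as each. *)
Definition diagonal (cH cL : code unit) (cU : code Empty_set) (m x s : nat) : nat :=
  match approx cL (query m x) s 1 with
  | 0 => 0
  | S k => prod (forbidden cH cL cU m x s) (S k)
  end.

Lemma computable_diagonal cH cL cU m x s :
  computable m -> computable x -> computable s ->
  computable (fun z => diagonal cH cL cU (m z) (x z) (s z)).
Proof.
intros Hm Hx Hs.
enough (H : computable3 (diagonal cH cL cU)).
{ apply computable_ext with (1 := computable_comp H
    (computable_pair Hm (computable_pair Hx Hs))).
  intros z; now rewrite !pi2_pair, !pi1_pair. }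
unfold diagonal, forbidden, query, punctured; auto 30 with computability.
Qed.

Definition zeros : baire := fun _ => 0.

Lemma punctured_sound x p z v :
  (forall i, i <> x -> p i = 0) -> punctured x z = S v -> p z = v.
Proof.
unfold punctured, dist; intros Hp E.
destruct (z - x + (x - z)) eqn:D; [discriminate|]; rewrite Hp by lia; congruence.
Qed.

Lemma interleave_sound o o' p p' :
  (forall z v, o z = S v -> p z = v) -> (forall z v, o' z = S v -> p' z = v) ->
  forall z v, interleave o o' z = S v -> interleave p p' z = v.
Proof. intros H H' z v; unfold interleave; destruct (Nat.even z); auto. Qed.

Lemma rep_pair_const p m : rep (prod_space baire_space nat_space) (interleave p (fun _ => m)) (p, m).
Proof. simpl; now rewrite evens_interleave, odds_interleave. Qed.

Lemma G_ge_not_le_K_N phi : acceptable phi -> ~ weihrauch_le (G_ge phi) K_N.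
Proof.
intros Hphi Hle.
destruct (weihrauch_le_pointwise Hle) as (cH & cL & Hred).
destruct (universal_code Hphi) as [cU HcU].
destruct (goedel_number_exists Hphi (computable_const 0)) as [e0 He0]; fold zeros in He0.
assert (Hin : forall p m i, computable p -> goedel_number phi p i -> i <= m ->
  exists j, G_ge phi (p, m) j).
{ intros p m i Hp Hi Him; exists i; repeat split; trivial; try apply Hi.
  apply above_kolmogorov_iff; eauto. }
(* If the hole [x] lies far enough out and [s] is large, no candidate is left undecided. *)
assert (Hsearch : forall m, e0 <= m ->
  exists w, 1 - diagonal cH cL cU m (pi1 w) (pi2 w) = 0).
{ intros m Hm.
  destruct (Hred (interleave zeros (fun _ => m)) (zeros, m)) as
    (r & [q k] & HL & [Hq Hk] & [w [Hw _]] & Hval).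
  { apply rep_pair_const. }
  { exact (Hin _ _ _ (computable_const 0) He0 Hm). }
  simpl in Hq, Hk; unfold odds in Hk; simpl in Hk.
  assert (Hagree : forall N x, N <= x -> agree_below N (query m x) (interleave zeros (fun _ => m))).
  { intros N x HN; apply agree_below_interleave; intros z Hz; trivial.
    unfold punctured, dist; destruct (z - x + (x - z)) eqn:D; trivial; lia. }
  (* For a surviving candidate the bound [N] depends on [x]: it contains the time that
     the function with the computed index needs on input [x]. *)
  assert (Hn : forall n, n < S k -> exists X, forall x, X <= x ->
    exists N, forall s, N <= s -> forbidden cH cL cU m x s n <> 0).
  { intros n Hn; destruct (classic (exists t, q t = n)) as [[t Ht]|Hnt].
    - pose proof (HL (2 * t)) as Ht'; subst q; unfold evens in Ht; rewrite Ht in Ht'.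
      destruct (approx_complete _ _ _ _ Ht') as [N HN].
      exists N; intros x Hx; exists (max N (S t)); intros s Hs; unfold forbidden.
      rewrite prod_zero with (i := t); [discriminate|lia|].
      rewrite HN; [unfold dist; lia|lia|]; intros _; apply Hagree, Hx.
    - destruct (Hval (fun _ => n) n) as (a & i & HH & Hi & _ & Hg); [reflexivity| |].
      { split; [exact Hw|]; split; [lia|]; intros t Ht; apply Hnt; eauto. }
      simpl in Hi; pose proof (HH 0) as HH0; rewrite Hi in HH0.
      destruct (approx_complete _ _ _ _ HH0) as [X HX].
      exists X; intros x Hx.
      assert (Hix : eval no_oracle cU << i, x >> 0) by now apply HcU, Hg.
      destruct (approx_complete _ _ _ _ Hix) as [N HN].
      exists (max N X); intros s Hs; unfold forbidden.
      destruct (prod _ s); [discriminate|].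
      rewrite HX; [|lia|].
      + rewrite HN; [discriminate|lia|]; intros [].
      + intros _; apply agree_below_interleave; [apply Hagree, Hx|]; intros z _; trivial. }
  destruct (eventually_all _ Hn) as [X HX].
  pose proof (HL 1) as Hk1; rewrite Hk in Hk1.
  destruct (approx_complete _ _ _ _ Hk1) as [N HN].
  set (x := max X N).
  destruct (eventually_all _ (HX x ltac:(lia))) as [N' HN'].
  exists << x, max N N' >>; rewrite pi1_pair, pi2_pair; unfold diagonal.
  rewrite HN; [|lia|intros _; apply Hagree; lia].
  destruct (prod _ (S k)) eqn:E; [|lia].
  apply prod_zero_inv in E; destruct E as (n & Hnk & Hn0).
  contradict Hn0; apply HN'; trivial; lia. }
destruct (computable_search
  (f := fun e w => 1 - diagonal cH cL cU (e + e0) (pi1 w) (pi2 w))) as (g & Hg & Hg0).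
{ unfold computable2; auto using computable_diagonal with computability. }
{ intros e; apply Hsearch; lia. }
set (f := fun e y => match dist y (pi1 (g e)) with
                     | 0 => diagonal cH cL cU (e + e0) (pi1 (g e)) (pi2 (g e))
                     | S _ => 0 end).
assert (Hf : computable2 f).
{ pose proof (fun a => computable_comp (g := a) Hg) as Hg'.
  unfold f, computable2; auto 10 using computable_diagonal with computability. }
(* On the function [p] with index [e], the candidates behave as on the zero function. *)
destruct (recursion_theorem Hphi Hf) as [e He].
specialize (Hg0 e); unfold f in He.
set (x := pi1 (g e)) in *; set (s := pi2 (g e)) in *; set (m := e + e0) in *.
set (p := fun y => match dist y x with 0 => diagonal cH cL cU m x s | S _ => 0 end).
fold p in He.
assert (Hp : computable p).
{ unfold p, dist; auto 10 with computability. }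
destruct (Hred (interleave p (fun _ => m)) (p, m)) as
  (r & [q k] & HL & [Hq Hk] & [n Hn] & Hval).
{ apply rep_pair_const. }
{ apply (Hin p m e); trivial; lia. }
simpl in Hq, Hk; unfold odds in Hk; simpl in Hk.
assert (Hsound : forall z v, query m x z = S v -> interleave p (fun _ => m) z = v).
{ apply interleave_sound; [|congruence]; intros z v; apply punctured_sound.
  intros i Hi; unfold p; destruct (dist i x) eqn:D; trivial; unfold dist in D; lia. }
destruct (Hval (fun _ => n) n) as (a & i & HH & Hi & _ & Hgi); [reflexivity|exact Hn|].
simpl in Hi; pose proof (HH 0) as HH0; rewrite Hi in HH0.
destruct Hn as (_ & Hnk & Hnq).
assert (Hpx : p x = diagonal cH cL cU m x s).
{ unfold p, dist; now rewrite Nat.sub_diag. }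
assert (Hd : diagonal cH cL cU m x s <> 0) by lia.
unfold diagonal in Hd, Hpx; destruct (approx cL (query m x) s 1) as [|k'] eqn:Ek; [easy|].
assert (k' = k) as ->.
{ rewrite <- Hk; apply (eval_functional (fun _ => interleave p (fun _ => m)) cL 1); [|apply HL].
  apply approx_sound with (2 := Ek); auto. }
pose proof (prod_ge (forbidden cH cL cU m x s) Hd (i := n) ltac:(lia)) as Hge.
destruct (forbidden cH cL cU m x s n) as [|v] eqn:EF.
{ apply Hd, prod_zero with n; trivial; lia. }
unfold forbidden in EF.
destruct (prod (fun t => _) s) eqn:Et in EF.
- apply prod_zero_inv in Et; destruct Et as (t & _ & Ht).
  apply (Hnq t); rewrite <- Hq; unfold evens.
  apply (eval_functional (fun _ => interleave p (fun _ => m)) cL (2 * t)); [apply HL|].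
  apply approx_sound with (o := query m x) (s := s); auto; unfold dist in Ht; lia.
- destruct (approx cH _ s 0) as [|i'] eqn:Ei in EF; [discriminate|].
  assert (i' = i) as ->.
  { apply (eval_functional (fun _ => interleave (interleave p (fun _ => m)) (fun _ => n)) cH 0);
      trivial.
    apply approx_sound with (2 := Ei); intros _; apply interleave_sound; trivial; congruence. }
  assert (Hv : phi i x v).
  { apply HcU, approx_sound with (2 := EF); intros []. }
  apply Hgi in Hv; lia.
Qed.

(** * The jump of compact choice does not bound Kolmogorov complexity *)

(** Every number is read as the code [<< n, u >>] of a string of length [n], whose letters
    are the first components of [u] and of its iterated second components.  As every number
    is a code, a search over strings is a search over all numbers. *)
Definition len (w : nat) : nat := pi1 w.

Definition letter (w i : nat) : nat := pi1 (nat_rect (fun _ => nat) (pi2 w) (fun _ r => pi2 r) i).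

(* The string as a partial oracle. *)
Definition entry (w i : nat) : nat := match S i - len w with 0 => S (letter w i) | S _ => 0 end.

Definition prefix (w : nat) (p : baire) : Prop := forall i, i < len w -> letter w i = p i.

Lemma prefix_exists p n : exists w, len w = n /\ prefix w p.
Proof.
enough (H : forall p, exists u, forall i, i < n ->
  pi1 (nat_rect (fun _ => nat) u (fun _ r => pi2 r) i) = p i).
{ destruct (H p) as [u Hu]; exists << n, u >>; unfold prefix, letter, len.
  now rewrite pi1_pair, pi2_pair. }
clear p; induction n as [|n IHn]; intros p; [exists 0; lia|].
destruct (IHn (fun i => p (S i))) as [u Hu]; exists << p 0, u >>.
intros [|i] Hi; [apply pi1_pair|].
rewrite <- Hu by lia; f_equal; clear; induction i as [|i IHi]; [apply pi2_pair|].
simpl in *; now rewrite IHi.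
Qed.

Lemma prefix_sound w p : prefix w p -> forall z v, entry w z = S v -> p z = v.
Proof.
unfold entry; intros Hw z v; destruct (S z - len w) eqn:E; [|discriminate].
rewrite Hw by lia; congruence.
Qed.

Lemma prefix_agree w p : prefix w p -> agree_below (len w) (entry w) p.
Proof.
intros Hw z Hz; unfold entry; replace (S z - len w) with 0 by lia; now rewrite Hw.
Qed.

(** The last known value at position 1 in the sequence computed by [cL], which converges to
    a name of the instance [(q, k)] of compact choice.  Position 1 of that name holds [k]. *)
Definition bound (cL : code unit) (w : nat) : nat :=
  nat_rect (fun _ => nat) 0
    (fun t k => match approx cL (entry w) (len w) << t, 1 >> with 0 => k | S v => v end)
    (len w).

(* A known answer [v] contributes [S v] to the sum, a missing one [0]. *)
Definition guess (cH cL : code unit) (w : nat) : nat :=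
  sum (fun n => approx cH (interleave (entry w) (fun _ => S n)) (len w) 0) (S (bound cL w)).

Lemma computable_letter a b : computable a -> computable b -> computable (fun z => letter (a z) (b z)).
Proof. intros Ha Hb; unfold letter; auto 20 with computability. Qed.

#[local] Hint Resolve computable_letter : computability.

Lemma computable_guess cH cL : computable (guess cH cL).
Proof. unfold guess, bound, entry, len; auto 40 with computability. Qed.

(** Not effective: whether the limit is [0] depends on whether the program halts. *)
Lemma approx_stabilizes (c : code unit) p x :
  exists y N, forall s o, N <= s -> agree_below N o p ->
    (forall z v, o z = S v -> p z = v) -> approx c o s x = y.
Proof.
destruct (classic (exists y, eval (fun _ => p) c x y)) as [[y Hy]|H].
- destruct (approx_complete _ _ _ _ Hy) as [N HN]; exists (S y), N; intros s o Hs Ho _.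
  apply HN; auto.
- exists 0, 0; intros s o _ _ Ho.
  destruct (approx c o s x) as [|y] eqn:E; trivial.
  destruct H; exists y; apply approx_sound with (2 := E); auto.
Qed.

(** As soon as the prefix suffices to compute an entry of index at least [T], older entries
    no longer matter. *)
Lemma bound_converges cL p r k :
  (forall n, eval (fun _ => p) cL n (r n)) ->
  (exists T, forall t, T <= t -> r << t, 1 >> = k) ->
  exists N, forall w, N <= len w -> prefix w p -> bound cL w = k.
Proof.
intros HL [T HT].
destruct (approx_complete _ _ _ _ (HL << T, 1 >>)) as [N HN].
exists (max N (S T)); intros w Hw Hp; unfold bound.
assert (Happ : forall t v, T <= t -> approx cL (entry w) (len w) << t, 1 >> = S v -> v = k).
{ intros t v Ht E; rewrite <- (HT t Ht); symmetry.
  apply (eval_functional (fun _ => p) cL << t, 1 >>); [apply HL|].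
  apply approx_sound with (2 := E); intros _; now apply prefix_sound. }
assert (HTw : approx cL (entry w) (len w) << T, 1 >> = S (r << T, 1 >>)).
{ apply HN; [lia|]; intros _; apply agree_below_le with (len w); [lia|now apply prefix_agree]. }
assert (HTn : S T <= len w) by lia; revert HTn.
generalize (len w) at 1 3; induction 1 as [|n Hn IHn]; cbn [nat_rect].
- rewrite HTw; auto.
- destruct (approx cL (entry w) (len w) << n, 1 >>) eqn:E; trivial.
  apply Happ with n; trivial; lia.
Qed.

(** Among the summands of the limit guess is the answer that [cH] computes from a correct
    solution [n], and that answer is at least the complexity of [p]. *)
Lemma guess_converges phi cH cL p :
  reduces_pointwise (K_ge phi) (jump K_N) cH cL -> acceptable phi -> computable p ->
  exists b N, above_kolmogorov phi p b /\
    forall w, N <= len w -> prefix w p -> guess cH cL w = b.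
Proof.
intros Hred Hphi Hp.
destruct (Hred p p) as (r & [q k] & HL & Hr & [n Hn] & Hval).
{ reflexivity. }
{ destruct (goedel_number_exists Hphi Hp) as [i Hi]; exists i; split; trivial.
  apply above_kolmogorov_iff; eauto. }
destruct Hr as (r' & Hlim & _ & Hk); simpl in Hk; unfold odds in Hk; simpl in Hk.
destruct (@bound_converges cL p r k HL) as [N HN]; [rewrite <- Hk; apply Hlim|].
assert (Hstab : forall n, exists y N, forall w, N <= len w -> prefix w p ->
  approx cH (interleave (entry w) (fun _ => S n)) (len w) 0 = y).
{ intros n'; destruct (approx_stabilizes cH (interleave p (fun _ => n')) 0) as (y & M & HM).
  exists y, M; intros w Hw Hpw; apply HM; trivial.
  - apply agree_below_interleave; [|intros z _; trivial].
    apply agree_below_le with (len w); [lia|now apply prefix_agree].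
  - apply interleave_sound; [now apply prefix_sound|congruence]. }
set (y := fun n => proj1_sig (constructive_indefinite_description _ (Hstab n))).
assert (Hy : forall n, exists N, forall w, N <= len w -> prefix w p ->
  approx cH (interleave (entry w) (fun _ => S n)) (len w) 0 = y n).
{ intros n'; exact (proj2_sig (constructive_indefinite_description _ (Hstab n'))). }
destruct (eventually_all (fun n l => forall w, l <= len w -> prefix w p ->
  approx cH (interleave (entry w) (fun _ => S n)) (len w) 0 = y n) (k := S k)) as [M HM].
{ intros n' _; destruct (Hy n') as [M HM]; exists M; intros l Hl w Hw; apply HM; lia. }
exists (sum y (S k)), (max N M); split.
- destruct (Hval (fun _ => n) n) as (a & v & HH & Hv & _ & Hab); [reflexivity|exact Hn|].
  apply above_kolmogorov_iff in Hab; destruct Hab as (i & Hi & Hiv).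
  apply above_kolmogorov_iff; exists i; split; trivial.
  simpl in Hv; pose proof (HH 0) as H0; rewrite Hv in H0.
  destruct (approx_complete _ _ _ _ H0) as [M' HM'].
  destruct (prefix_exists p (max M M')) as (w & Hw & Hpw).
  destruct Hn as (_ & Hnk & _).
  assert (E : y n = S v).
  { rewrite <- (HM M (le_n M) n ltac:(lia) w ltac:(lia) Hpw); apply HM'; [lia|].
    intros _; apply agree_below_interleave; [|intros z _; trivial].
    apply agree_below_le with (len w); [lia|now apply prefix_agree]. }
  pose proof (@sum_ge y (S k) n ltac:(lia)); lia.
- intros w Hw Hpw; unfold guess; rewrite HN by (trivial; lia).
  apply sum_ext; intros n' Hn'; apply (HM M); trivial; lia.
Qed.

(** Finitely many partial functions take finitely many values at [i]; hence the functions
    of complexity at most [b] omit a value at [i]. *)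
Lemma dominate_values (phi : nat -> pfun nat nat) i b :
  exists v, forall j y, j <= b -> phi j i y -> y < v.
Proof.
induction b as [|b [v Hv]].
- destruct (classic (exists y, phi 0 i y)) as [[y Hy]|H].
  + exists (S y); intros j y' Hj Hy'; replace j with 0 in Hy' by lia.
    rewrite (graph_functional (phi 0) _ _ _ Hy' Hy); lia.
  + exists 0; intros j y Hj Hy; replace j with 0 in Hy by lia; destruct H; eauto.
- destruct (classic (exists y, phi (S b) i y)) as [[y Hy]|H].
  + exists (max v (S y)); intros j y' Hj Hy'; destruct (Nat.eq_dec j (S b)) as [->|].
    * rewrite (graph_functional (phi (S b)) _ _ _ Hy' Hy); lia.
    * assert (y' < v) by (apply (Hv j); trivial; lia); lia.
  + exists v; intros j y Hj Hy; destruct (Nat.eq_dec j (S b)) as [->|].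
    * destruct H; eauto.
    * apply (Hv j); trivial; lia.
Qed.

(** A function of prefixes that can always be made to change does so infinitely often along
    some computable sequence, namely the union of a computable chain of strings, each found
    by searching for a proper extension of the previous one with another value. *)
Lemma changing_guess_diverges M :
  computable M ->
  (forall w, exists v, len w < len v /\ prefix w (letter v) /\ M v <> M w) ->
  exists p, computable p /\
    forall N, exists w v, N <= len w /\ N <= len v /\ prefix w p /\ prefix v p /\ M w <> M v.
Proof.
intros HM Hchange.
destruct (computable_search (f := fun w v =>
    (S (len w) - len v) + sum (fun i => dist (letter w i) (letter v i)) (len w) +
    (1 - dist (M v) (M w)))) as (next & Hnext & Hnext0).
{ pose proof (fun a => computable_comp (g := a) HM) as HM'.
  unfold len; auto 20 with computability. }
{ intros w; destruct (Hchange w) as (v & Hlen & Hwv & HMv); exists v.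
  rewrite sum_zero by (intros i Hi; unfold dist; rewrite (Hwv i Hi); lia).
  unfold dist; lia. }
assert (Hstep : forall w, len w < len (next w) /\ prefix w (letter (next w)) /\
  M (next w) <> M w).
{ intros w; specialize (Hnext0 w); split; [lia|]; split.
  - intros i Hi.
    pose proof (sum_ge (fun i => dist (letter w i) (letter (next w) i)) Hi) as H.
    cbv beta in H; unfold dist in H at 1; lia.
  - intros E; rewrite E in Hnext0; unfold dist in Hnext0; lia. }
clear Hnext0.
set (W := nat_rect (fun _ => nat) 0 (fun _ w => next w)).
assert (Hlen : forall j, j <= len (W j)).
{ induction j as [|j IHj]; [lia|]; destruct (Hstep (W j)) as [H _]; simpl; lia. }
assert (Hext : forall j l, j <= l ->
  len (W j) <= len (W l) /\ prefix (W j) (letter (W l))).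
{ induction 1 as [|l Hl [IH1 IH2]]; [split; trivial; intros i _; trivial|].
  destruct (Hstep (W l)) as (H1 & H2 & _); simpl; split; [lia|].
  intros i Hi; rewrite (IH2 i Hi); apply H2; lia. }
set (p := fun i => letter (W (S i)) i).
assert (Hpre : forall j, prefix (W j) p).
{ intros j i Hi; unfold p; destruct (le_lt_dec j (S i)) as [H|H].
  - now apply Hext.
  - symmetry; apply (Hext (S i) j); [lia|]; apply (Hlen (S i)). }
exists p; split.
- pose proof (fun a => computable_comp (g := a) Hnext) as Hnext'.
  unfold p, W; auto 20 with computability.
- intros N; exists (W N), (W (S N)); repeat split; trivial.
  + specialize (Hlen (S N)); lia.
  + apply not_eq_sym, Hstep.
Qed.

Lemma K_ge_not_le_jump_K_N phi : acceptable phi -> ~ weihrauch_le (K_ge phi) (jump K_N).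
Proof.
intros Hphi Hle.
destruct (weihrauch_le_pointwise Hle) as (cH & cL & Hred).
pose proof (fun p => @guess_converges phi cH cL p Hred Hphi) as Hconv.
destruct (changing_guess_diverges (computable_guess cH cL)) as (p & Hp & Hdiv).
- intros w; apply NNPP; intros Hlock.
  (* Continue [w] with a value [V] that no function with index at most [guess cH cL w]
     takes at position [len w]. *)
  destruct (dominate_values phi (len w) (guess cH cL w)) as [V HV].
  set (p := fun i => match S i - len w with 0 => letter w i | S _ => V end).
  assert (Hp : computable p) by (unfold p; auto 10 with computability).
  assert (Hwp : prefix w p).
  { intros i Hi; unfold p; now replace (S i - len w) with 0 by lia. }
  destruct (Hconv p Hp) as (b & N & Hb & HN).
  destruct (prefix_exists p (max N (S (len w)))) as (v & Hv & Hvp).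
  assert (E : guess cH cL w = b).
  { rewrite <- (HN v ltac:(lia) Hvp); apply NNPP; intros Hne; apply Hlock; exists v.
    split; [lia|]; split; [|auto].
    intros i Hi; rewrite (Hwp i Hi); symmetry; apply Hvp; lia. }
  apply above_kolmogorov_iff in Hb; destruct Hb as (i & Hi & Hib).
  enough (V < V) by lia.
  apply (HV i); [lia|]; apply Hi; unfold p.
  now replace (S (len w) - len w) with 1 by lia.
- destruct (Hconv p Hp) as (b & N & _ & HN).
  destruct (Hdiv N) as (w & v & Hw & Hv & Hwp & Hvp & Hne).
  apply Hne; rewrite !HN; trivial.
Qed.

Theorem proposition20 (phi : nat -> pfun nat nat) (phi_acceptable : acceptable phi) :
  ~ weihrauch_le (K_ge phi) (jump K_N) /\
  ~ weihrauch_le (G_ge phi) K_N.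
Proof.
split; [now apply K_ge_not_le_jump_K_N|now apply G_ge_not_le_K_N].
Qed.
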